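(* Let $(E,d)$ and $E'$ be Polish spaces, $F:E\times E'\to E$ a measurable map, and $(\zeta_t)_{t\in\mathbb{Z}}$ an $E'$-valued process adapted to a filtration $(\mathcal{F}_t)_{t\in\mathbb{Z}}$. Set $f_t=F(\cdot,\zeta_t)$ and $f_s^t=f_t\circ f_{t-1}\circ\cdots\circ f_s$ for $s\le t$ (with $f_t^{t-1}(x)=x$). Let $p\ge 1$, $L>0$, $\kappa\in(0,1)$ and an integer $m\ge1$ be such that: (A1) there exists $x_0\in E$ with $\sup_{t\in\mathbb{Z}}\mathbb{E}[d^p(f_t(x_0),x_0)]<\infty$; (A2) for every $t\in\mathbb{Z}$, almost surely, for all $(x,y)\in E^2$ simultaneously, $$\mathbb{E}[d^p(f_t(x),f_t(y))\mid\mathcal{F}_{t-1}]\le L^p d^p(x,y)\quad\text{and}\quad \mathbb{E}[d^p(f_t^{t+m-1}(x),f_t^{t+m-1}(y))\mid\mathcal{F}_{t-1}]\le \kappa^p d^p(x,y).$$ Then: 1. For every $(x,t)\in E\times\mathbb{Z}$ there is an $E$-valued random variable $X_t(x)$ with $\sup_{t}\|d(X_t(x),x_0)\|_p<\infty$ and $\sup_t\|d(f_{t-s}^t(x),X_t(x))\|_p=O(\kappa^{s/m})$ as $s\to\infty$; moreover $f_{t-s}^t(x)\to X_t(x)$ almost surely as $s\to\infty$. 2. For $x\ne y$, $\mathbb{P}(X_t(x)\neq X_t(y))=0$; one sets $X_t=X_t(x)$. 3. If $(\zeta_t)$ is stationary, the process $((X_t,\zeta_t))_{t\in\mathbb{Z}}$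 is stationary, and it is ergodic if $(\zeta_t)$ is stationary and ergodic. 4. If $(Y_t)_{t\in\mathbb{Z}}$ is non-anticipative (i.e. $Y_t$ is $\mathcal{F}_t$-measurable), satisfies $Y_t=f_t(Y_{t-1})$ for all $t$ and $\sup_j\mathbb{E}[d^p(Y_j,x_0)]<\infty$, then $Y_t=X_t$ a.s. for all $t$.
   Context: $\|X\|_p=(\mathbb{E}|X|^p)^{1/p}$. The conditional expectations in (A2) are understood through a regular version of the conditional distribution of $(\zeta_t,\dots,\zeta_{t+m-1})$ given $\mathcal{F}_{t-1}$, so that the inequalities hold for all $(x,y)$ outside a single null set. *)

(* Defs.v *)
From HB Require Import structures.
From mathcomp Require Import all_boot all_order all_algebra.
From mathcomp Require Import all_classical all_reals all_analysis measurable_realfun.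

Unset Printing Implicit Defensive.
Import Order.TTheory GRing.Theory Num.Theory.
Local Open Scope classical_set_scope.
Local Open Scope ring_scope.

Section defs.
Context {R : realType}.

Definition is_metric {T} (d : T -> T -> R) :=
  [/\ (forall x y, 0 <= d x y), (forall x y, d x y = 0 <-> x = y),
      (forall x y, d x y = d y x) & (forall x y z, d x z <= d x y + d y z)].

Definition d_open {T} (d : T -> T -> R) (U : set T) :=
  forall x, U x -> exists2 r : R, 0 < r & [set y | d x y < r] `<=` U.

Definition d_separable {T} (d : T -> T -> R) :=
  exists D : set T, countable D /\
    forall x (e : R), 0 < e -> exists2 y, D y & d x y < e.

Definition d_complete {T} (d : T -> T -> R) :=
  forall u : nat -> T,
    (forall e : R, 0 < e -> exists N, forall n k, (N <= n)%N -> (N <= k)%N ->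
        d (u n) (u k) < e) ->
    exists l, forall e : R, 0 < e -> exists N, forall n, (N <= n)%N -> d (u n) l < e.

Definition polish_metric {T} (d : T -> T -> R) :=
  [/\ is_metric d, d_separable d & d_complete d].

Definition borel_for {dT} {T : measurableType dT} (d : T -> T -> R) :=
  forall A : set T, measurable A <-> <<s (d_open d) >> A.

Definition polish_space_with {dT} {T : measurableType dT} (d : T -> T -> R) :=
  polish_metric d /\ borel_for d.

Definition polish_space {dT} (T : measurableType dT) :=
  exists d : T -> T -> R, polish_space_with d.

End defs.

Definition meas_wrt {dO dS} {Omega : measurableType dO} {S : measurableType dS}
  (G : set (set Omega)) (X : Omega -> S) :=
  forall B : set S, measurable B -> G (X @^-1` B).

Definition filtration {dO} {Omega : measurableType dO} (Fl : int -> set (set Omega)) :=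
  [/\ (forall t, sigma_algebra setT (Fl t)),
      (forall t, Fl t `<=` measurable) &
      (forall s t : int, (s <= t)%R -> Fl s `<=` Fl t)].

Definition cyl_gen {dS} (S : measurableType dS) : set (set (int -> S)) :=
  [set A | exists (t : int) (B : set S), measurable B /\ A = [set u | B (u t)]].

Definition cyl_sigma {dS} (S : measurableType dS) : set (set (int -> S)) :=
  <<s (cyl_gen S) >>.

Definition shift1 {S} (u : int -> S) : int -> S := fun t => u (t + 1)%R.

Definition stationary {dO dS} {Omega : measurableType dO} {S : measurableType dS}
  {R : realType} (P : probability Omega R) (Z : int -> Omega -> S) :=
  forall A, cyl_sigma S A ->
    P [set w | A (fun t => Z t w)] = P [set w | A (shift1 (fun t => Z t w))].

Definition ergodic {dO dS} {Omega : measurableType dO} {S : measurableType dS}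
  {R : realType} (P : probability Omega R) (Z : int -> Omega -> S) :=
  stationary P Z /\
  forall A, cyl_sigma S A -> (forall u, A u <-> A (shift1 u)) ->
    P [set w | A (fun t => Z t w)] = 0%E \/ P [set w | A (fun t => Z t w)] = 1%E.

(** fiter F zeta n s x w = f_{s+n-1} o ... o f_s (x)   (= x when n = 0),
    where f_t = F(., zeta_t).  Hence f_s^t = fiter F zeta (t-s+1) s. *)
Fixpoint fiter {E E' Omega : Type} (F : E * E' -> E) (zeta : int -> Omega -> E')
  (n : nat) (s : int) (x : E) (w : Omega) : E :=
  match n with
  | 0%N => x
  | n'.+1 => F (fiter F zeta n' s x w, zeta (s + n'%:Z)%R w)
  end.

Fixpoint tfiter {E E' : Type} (F : E * E' -> E) (z : nat -> E') (n : nat) (x : E) : E :=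
  match n with
  | 0%N => x
  | n'.+1 => F (tfiter F z n' x, z n')
  end.

(** ** E'^m, realised as sequences nat -> E' with the sigma-algebra generated by
    the first m coordinates (isomorphic to the product sigma-algebra of E'^m) *)
Definition tup_gen {dE'} (E' : measurableType dE') (m : nat) : set (set (nat -> E')) :=
  [set A | exists i B, (i < m)%N /\ measurable B /\ A = [set z | B (z i)]].

Definition tupType {dE'} (E' : measurableType dE') (m : nat) :=
  g_sigma_algebraType (tup_gen E' m).

Definition reg_cond_distr {dO dE'} {Omega : measurableType dO}
  {E' : measurableType dE'} {R : realType} (P : probability Omega R)
  (G : set (set Omega)) (zeta : int -> Omega -> E') (t : int) (m : nat)
  (K : Omega -> probability (tupType E' m) R) :=
  (forall B : set (tupType E' m), measurable B -> meas_wrt G (fun w => K w B)) /\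
  (forall A (B : set (tupType E' m)), G A -> measurable B ->
     P (A `&` [set w | B (fun i : nat => zeta (t + i%:Z)%R w)]) =
     (\int[P]_(w in A) K w B)%E).

(* Main.v *)
Require Import Defs.
From HB Require Import structures.
From mathcomp Require Import all_boot all_order all_algebra.
From mathcomp Require Import all_classical all_reals all_analysis measurable_realfun.
From mathcomp Require Import lra zify ring.
Import Order.TTheory GRing.Theory Num.Theory.
Import numFieldNormedType.Exports.
Local Open Scope classical_set_scope.
Local Open Scope ring_scope.

(** Freezing F_{t-1}-measurable random points in (A2) shows that m random maps
    contract the pseudo-distance ||d(U, V)||_p by kappa, and a single one
    expands it by at most L. Hence n maps contract it by C theta^n with
    theta = kappa^(1/m). As f_{t-n-1}^t(x) and f_{t-n}^t(x) are the images of
    f_{t-n-1}(x) and x under the same n+1 maps, the pullback sequence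
    n |-> f_{t-n}^t(x) has geometrically small increments: it is almost surely
    Cauchy, and Fatou's lemma gives the rate of convergence to its limit
    X_t(x). Any other starting point, or any bounded non-anticipative solution,
    is merged with X_t(x) by the same contraction. Finally X_t(x) is one fixed
    measurable functional of the noise path shifted by t, so that
    t |-> (X_t, zeta_t) is the image of zeta under a measurable map commuting
    with the shift, which preserves stationarity and ergodicity. *)

(** * Measurability of the distance and of pointwise limits in a Polish space *)

Section metric_measurability.
Context {R : realType} {dE : measure_display} {E : measurableType dE}.
Context {d : E -> E -> R} (dP : polish_space_with d).

Let dC x y : d x y = d y x. Proof. by case: dP => -[[]]. Qed.
Let d_triangle x y z : d x z <= d x y + d y z.
Proof. by case: dP => -[[]]. Qed.

Lemma measurable_d_open U : d_open d U -> measurable U.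
Proof. by move=> oU; case: dP => _ /(_ U)->; exact: sub_sigma_algebra. Qed.

Lemma d_open_ball x r : d_open d [set y | d x y < r].
Proof.
move=> y /= xy; exists (r - d x y); first by rewrite subr_gt0.
move=> z /= yz; rewrite (le_lt_trans (d_triangle x y z))//.
by rewrite -ltrBrDl.
Qed.

Lemma measurable_dist_from (a : E) : measurable_fun setT (d a).
Proof.
apply: (measurability _ (RGenInftyO.measurableE R)) => _ [_ [r ->] <-].
rewrite setTI; apply: measurable_d_open.
rewrite (_ : _ @^-1` _ = [set y | d a y < r]); first exact: d_open_ball.
by apply/seteqP; split => y /=; rewrite in_itv.
Qed.

Lemma dense_sequence : exists u : nat -> E,
  forall x (e : R), 0 < e -> exists n, d (u n) x < e.
Proof.
case: dP => -[_ [D [cD dD]] _] _.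
have /pcard_surjP[u uD] : (D #<= [set: nat])%card := cD.
exists u => x e e0; have [y Dy xy] := dD x e e0.
by have [n _ uny] := uD y Dy; exists n; rewrite uny dC.
Qed.

(** Separability makes [d] measurable for the product sigma-algebra: it is the supremum of
    [|d (u n) x - d (u n) y|] over a dense sequence [u], so its superlevel sets are countable
    unions. *)
Lemma measurable_dist : measurable_fun setT (fun xy : E * E => d xy.1 xy.2).
Proof.
have [u ud] := dense_sequence.
apply: (measurability _ (RGenOInfty.measurableE R)) => _ [_ [r ->] <-].
rewrite setTI (_ : _ @^-1` _ = \bigcup_n
    ((fun xy : E * E => `|d (u n) xy.1 - d (u n) xy.2|) @^-1` `]r, +oo[)).
  apply: bigcupT_measurable => n; rewrite -[X in measurable X]setTI.
  apply: measurableT_comp => //.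
  by apply: measurable_funB; apply: measurableT_comp => //;
    exact: measurable_dist_from.
apply/seteqP; split => [[x y]|[x y] [n _]] /=; rewrite !in_itv/= !andbT => rxy.
(* Half the gap suffices: [d (u n) y - d (u n) x >= d x y - 2 * d (u n) x > r]. *)
- have e0 : 0 < (d x y - r) / 2 by rewrite divr_gt0// subr_gt0.
  have [n unx] := ud x _ e0; exists n => //=; rewrite in_itv/= andbT.
  rewrite distrC (lt_le_trans _ (ler_norm _))//.
  have := d_triangle x (u n) y; rewrite (dC x (u n)) => h.
  by lra.
- apply: (lt_le_trans rxy); rewrite ler_norml; apply/andP; split.
    by have := d_triangle (u n) x y; lra.
  by have := d_triangle (u n) y x; rewrite (dC y x); lra.
Qed.

Lemma measurable_fun_dist {dT} {T : measurableType dT} (f g : T -> E) :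
  measurable_fun setT f -> measurable_fun setT g ->
  measurable_fun setT (fun w => d (f w) (g w)).
Proof.
move=> mf mg; have mfg := measurable_fun_pair mf mg.
exact: measurableT_comp measurable_dist mfg.
Qed.

(** An open [U] is the union of the closed sets [V k] of points whose ball of radius [1/(k+1)] lies
    in [U]; the limit is in [U] exactly when some [V k] eventually contains the sequence. *)
Lemma measurable_fun_dlim {dT} {T : measurableType dT} (g : nat -> T -> E)
    (f : T -> E) :
  (forall n, measurable_fun setT (g n)) ->
  (forall w (e : R), 0 < e ->
     exists N, forall n, (N <= n)%N -> d (g n w) (f w) < e) ->
  measurable_fun setT f.
Proof.
move=> mg gf.
have mE : @measurable _ E = <<s d_open d >>.
  by apply/seteqP; split => A; case: dP => _ /(_ A)[].
apply: (measurability _ mE) => _ [U oU <-].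
pose V k := [set y | [set z | d y z < k.+1%:R^-1] `<=` U].
have mV k : measurable (V k).
  rewrite -[V k]setCK; apply/measurableC/measurable_d_open => y /=.
  move=> /existsNP[z /not_implyP[yz nUz]].
  exists (k.+1%:R^-1 - d y z) => [|y' /= yy' Vy']; first by rewrite subr_gt0.
  apply/nUz/Vy' => /=; rewrite (le_lt_trans (d_triangle y' y z))//.
  by rewrite -ltrBrDr dC.
rewrite setTI (_ : f @^-1` U = \bigcup_k \bigcup_N \bigcap_(n in [set n | (N <= n)%N])
   (g n @^-1` (V k))).
  do 2 (apply: bigcupT_measurable => ?).
  apply: bigcap_measurableType => n _.
  by rewrite -[X in measurable X]setTI; exact: mg.
apply/seteqP; split => w /=.
- move=> Ufw; have [r r0 rU] := oU _ Ufw.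
  (* With [1/(k+1) < r/2], the ball of that radius around a point [1/(k+1)]-close to [f w] stays
     inside the [r]-ball around [f w]. *)
  have [k _ kr] : exists2 k : nat, true & k.+1%:R^-1 < r / 2.
    have := @near_infty_natSinv_lt R (PosNum (divr_gt0 r0 (ltr0n R 2))).
    by move=> [k _ /(_ k (leqnn k))/= ?]; exists k.
  have [N Nk] := gf w k.+1%:R^-1 (ltac:(by rewrite invr_gt0 ltr0n)).
  exists k => //; exists N => // n /= Nn z /= gz; apply: rU => /=.
  have := d_triangle (f w) (g n w) z; have := Nk n Nn; rewrite (dC (g n w) (f w)).
  by move: gz kr; set a := k.+1%:R^-1; lra.
- move=> [k _ [N _ h]].
  have [M Mk] := gf w k.+1%:R^-1 (ltac:(by rewrite invr_gt0 ltr0n)).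
  apply: (h (maxn N M)); first by rewrite /= leq_maxl.
  by apply: Mk; rewrite leq_maxr.
Qed.

End metric_measurability.

(* [pushforward] is canonically a measure only once the measurability of [f] is
   known, which unification cannot find: the instance is applied by hand. *)
Definition mpushforward {R : realType} {d1 d2 : measure_display}
  {T1 : measurableType d1} {T2 : measurableType d2}
  (mu : {measure set T1 -> \bar R}) {f : T1 -> T2}
  (mf : measurable_fun setT f) : {measure set T2 -> \bar R} :=
  measure_function_pushforward__canonical__measure_function_Measure mu mf.

(** * Disintegration along a regular conditional distribution *)

Section freezing.
Context {R : realType} {dO dT : measure_display} {Omega : measurableType dO}
  {T : measurableType dT} (P : probability Omega R) (G : set (set Omega)).
Hypotheses (sG : sigma_algebra setT G) (Gm : G `<=` measurable).
Context (Z : Omega -> T) (mZ : measurable_fun setT Z)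
  (K : Omega -> probability T R).
Hypothesis mK : forall B, measurable B -> meas_wrt G (fun w => K w B).
Hypothesis KP : forall A B, G A -> measurable B ->
  P (A `&` Z @^-1` B) = (\int[P]_(w in A) K w B)%E.

Local Notation OG := (g_sigma_algebraType G).

Lemma measurable_sub_id : measurable_fun setT (id : Omega -> OG).
Proof.
by move=> _ B; rewrite setTI /= [X in X -> _]/measurable/= sigma_algebra_id//; exact: Gm.
Qed.

Lemma meas_wrtP {dS} {S : measurableType dS} (X : Omega -> S) :
  meas_wrt G X <-> measurable_fun setT (X : OG -> S).
Proof.
split=> [mX _ B mB|mX B mB].
  by rewrite setTI; apply: sub_sigma_algebra; exact: mX.
have := mX measurableT B mB; rewrite setTI /measurable/= sigma_algebra_id//.
Qed.

(** The source is retyped as [OG], that is [Omega] carrying only [G]: measurability of the kernel is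
    then exactly [G]-measurability. *)
Definition frozen_kernel : OG -> {measure set T -> \bar R} := K.
Let mfrozen_kernel U : measurable U -> measurable_fun setT (frozen_kernel ^~ U).
Proof. by move=> mU; apply/meas_wrtP; exact: mK. Qed.

HB.instance Definition _ := isKernel.Build _ _ OG T R frozen_kernel mfrozen_kernel.
Let frozen_prob x : frozen_kernel x setT = 1%E.
Proof. exact: probability_setT. Qed.
HB.instance Definition _ := Kernel_isProbability.Build _ _ OG T R frozen_kernel frozen_prob.


(** The product of the Dirac mass at [w] with [K w], built as the image of [K w] under
    [z |-> (w, z)]; the [unit] factor fits the source that [kcomp] expects. *)
Definition joint_kernel (x : unit * OG) : {measure set (OG * T)%type -> \bar R} :=
  mpushforward (frozen_kernel x.2) (pair1_measurable x.2).

Let mjoint_kernel C : measurable C -> measurable_fun setT (joint_kernel ^~ C).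
Proof.
move=> mC.
have mk : measurable_fun setT (fun w : OG => frozen_kernel w (xsection C w)).
  by apply: measurable_fun_xsection_finite_kernel; rewrite inE.
have := measurableT_comp mk (@measurable_snd _ _ unit OG).
apply: eq_measurable_fun => -[[] w] _ /=.
rewrite /joint_kernel /= /pushforward; congr (frozen_kernel w _).
by apply/seteqP; split => z /=; rewrite /xsection/= inE.
Qed.

HB.instance Definition _ := isKernel.Build _ _ _ _ R joint_kernel mjoint_kernel.
Let joint_prob x : joint_kernel x setT = 1%E.
Proof. exact: probability_setT. Qed.
HB.instance Definition _ := Kernel_isProbability.Build _ _ _ _ R joint_kernel joint_prob.

Definition base_kernel (x : unit) : {measure set OG -> \bar R} :=
  mpushforward P measurable_sub_id.

Let mbase_kernel C : measurable C -> measurable_fun setT (base_kernel ^~ C).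
Proof. by move=> mC; exact: measurable_cst. Qed.

HB.instance Definition _ := isKernel.Build _ _ _ _ R base_kernel mbase_kernel.
Let base_prob x : base_kernel x setT = 1%E.
Proof. exact: probability_setT. Qed.
HB.instance Definition _ := Kernel_isProbability.Build _ _ _ _ R base_kernel base_prob.

Let mZid : measurable_fun setT ((fun w : Omega => (w, Z w)) : Omega -> OG * T).
Proof. exact: (@measurable_fun_pair _ _ _ Omega OG T id Z measurable_sub_id mZ). Qed.

(** By uniqueness on a generating pi-system it suffices to compare measurable rectangles, where the
    claim is the defining identity [KP] of the conditional distribution. *)
Lemma joint_law C : measurable C ->
  mpushforward P mZid C = kcomp base_kernel joint_kernel tt C.
Proof.
move=> mC.
pose H : set (set (OG * T)) :=
  [set A `*` B | A in measurable & B in measurable].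
apply: (measure_unique H (fun=> setT)) => //.
- exact: measurable_prod_measurableType.
- move=> _ _ [A1 mA1 [B1 mB1 <-]] [A2 mA2 [B2 mB2 <-]].
  by rewrite -setXI; exists (A1 `&` A2); [exact: measurableI|
    exists (B1 `&` B2) => //; exact: measurableI].
- by move=> _; exists setT => //; exists setT => //; rewrite setXTT.
- by rewrite bigcup_const//; exists 0%N.
- move=> _ [A mA [B mB <-]].
  have GA : G A by move: mA; rewrite /measurable/= sigma_algebra_id.
  rewrite [LHS](KP A B GA mB) /kcomp.
  have mKB := mfrozen_kernel B mB.
  transitivity (\int[base_kernel tt]_(w in A) frozen_kernel w B)%E.
    rewrite (ge0_integral_pushforward measurable_sub_id)//.
    by apply: measurable_funTS.
  rewrite integral_mkcond; apply: eq_integral => w _.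
  rewrite patchE /joint_kernel /mpushforward/= /pushforward.
  case: ifPn; rewrite ?(inE, notin_setE) => Aw.
    by congr (frozen_kernel w _); apply/seteqP; split => z //= -[].
  by rewrite (_ : _ @^-1` _ = set0) ?measure0//; apply/seteqP; split => z //= -[].
- by move=> _; rewrite /= /pushforward preimage_setT probability_setT ltry.
Qed.

Lemma measurable_frozen_integral (f : OG * T -> \bar R) :
  (forall x, 0 <= f x)%E -> measurable_fun setT f ->
  measurable_fun setT ((fun w => \int[K w]_z f (w, z))%E : OG -> \bar R).
Proof.
by move=> f0 mf; exact: (measurable_fun_integral_finite_kernel f frozen_kernel).
Qed.

(** The first argument of [f] sees only [G], so it can be held fixed while [Z] is averaged under
    [K w]; this is integration against [joint_law]. *)
Lemma freezing (f : OG * T -> \bar R) :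
  (forall x, 0 <= f x)%E -> measurable_fun setT f ->
  (\int[P]_w f (w, Z w) = \int[P]_w \int[K w]_z f (w, z))%E.
Proof.
move=> f0 mf.
transitivity (\int[mpushforward P mZid]_x f x)%E.
  by rewrite (ge0_integral_pushforward mZid).
transitivity (\int[kcomp base_kernel joint_kernel tt]_x f x)%E.
  by apply: eq_measure_integral => C mC _; rewrite joint_law.
rewrite integral_kcomp//.
transitivity (\int[base_kernel tt]_w \int[K w]_z f (w, z))%E.
  apply: eq_integral => w _ /=.
  by rewrite (ge0_integral_pushforward (pair1_measurable _)).
rewrite (ge0_integral_pushforward measurable_sub_id)//=.
- exact: measurable_frozen_integral.
- by move=> w _; apply: integral_ge0.
Qed.

End freezing.

(** Differentiability of the power settles a positive limit. At limit [0], the p-th power of [u n]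
    lies between [0] and [u n] as soon as [u n < 1], because [p >= 1]. *)
Lemma cvg_powR {R : realType} (p : R) (u : nat -> R) (l : R) :
  1 <= p -> (forall n, 0 <= u n) -> u @ \oo --> l ->
  (fun n => u n `^ p) @ \oo --> l `^ p.
Proof.
move=> p1 u0 ul.
have l0 : 0 <= l by apply: (cvgr_to_ge ul); exact: nearW.
move: l0; rewrite le_eqVlt => /predU1P[l0|l0]; last first.
  have dl : derivable (fun x : R => x `^ p) l 1.
    by apply: derivable_powR; rewrite in_itv/= l0.
  have cl : {for l, continuous (fun x : R => x `^ p)}.
    by apply: differentiable_continuous; exact/derivable1_diffP.
  exact: cvg_comp ul cl.
rewrite -l0 powR0; last by rewrite gt_eqF// (lt_le_trans ltr01).
apply: (@squeeze_cvgr _ _ _ _ (fun=> 0) u); last 2 first.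
- exact: cvg_cst.
- by rewrite l0.
near=> n; rewrite powR_ge0 /=.
have := u0 n; rewrite le_eqVlt => /predU1P[<-|un0].
  by rewrite powR0// gt_eqF// (lt_le_trans ltr01).
apply: ge1r_powR => //; rewrite un0/= ltW//; near: n.
by apply: (cvgr_lt l) => //; rewrite -l0.
Unshelve. all: by end_near. Qed.

(** * The L^p pseudo-distance between random points *)

Section Lp_distance.
Context {R : realType} {dO dE : measure_display}
  {Omega : measurableType dO} {E : measurableType dE}
  (P : probability Omega R) {d : E -> E -> R} {p : R}.
Hypotheses (dP : polish_space_with d) (p1 : 1 <= p).

Let d_ge0 x y : 0 <= d x y. Proof. by case: dP => -[[]]. Qed.
Let dC x y : d x y = d y x. Proof. by case: dP => -[[]]. Qed.
Let d_triangle x y z : d x z <= d x y + d y z.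
Proof. by case: dP => -[[]]. Qed.
Let d_eq0 x y : d x y = 0 <-> x = y. Proof. by case: dP => -[[]]. Qed.
Let p0 : 0 < p. Proof. exact: lt_le_trans p1. Qed.
Let pn0 : p != 0. Proof. by rewrite gt_eqF. Qed.

(** Valued in the extended reals, so that contraction estimates can be stated before any moment is
    known to be finite. *)
Definition Lpdist (U V : Omega -> E) : \bar R :=
  'N[P]_(p%:E)[(fun w => (d (U w) (V w))%:E)].

Lemma Lpdist_ge0 U V : (0 <= Lpdist U V)%E.
Proof. exact: Lnorm_ge0. Qed.

Lemma LpdistC U V : Lpdist U V = Lpdist V U.
Proof. by apply: eq_Lnorm => w; rewrite dC. Qed.

Lemma integral_powR_ge0 U V : (0 <= \int[P]_w ((d (U w) (V w)) `^ p)%:E)%E.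
Proof. by apply: integral_ge0 => w _; rewrite lee_fin powR_ge0. Qed.

Lemma LpdistE U V :
  Lpdist U V = ((\int[P]_w ((d (U w) (V w)) `^ p)%:E) `^ p^-1)%E.
Proof.
rewrite /Lpdist unlock; congr (_ `^ _)%E; apply: eq_integral => w _.
by rewrite abse_EFin ger0_norm.
Qed.

Lemma Lpdist_powR U V :
  (Lpdist U V `^ p = \int[P]_w ((d (U w) (V w)) `^ p)%:E)%E.
Proof. by rewrite LpdistE -poweRrM mulVf// poweRe1// integral_powR_ge0. Qed.

(** Passes from p-th moments, the form in which (A2) gets integrated, to [Lpdist], for which the
    triangle inequality is available. *)
Lemma Lpdist_lePow U V (c : R) U' V' : 0 <= c ->
  (\int[P]_w ((d (U w) (V w)) `^ p)%:E <=
    (c `^ p)%:E * \int[P]_w ((d (U' w) (V' w)) `^ p)%:E)%E ->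
  (Lpdist U V <= c%:E * Lpdist U' V')%E.
Proof.
move=> c0 h.
rewrite (_ : c%:E * _ = ((c `^ p)%:E * \int[P]_w ((d (U' w) (V' w)) `^ p)%:E)
   `^ p^-1)%E; last first.
  rewrite poweRM ?lee_fin ?powR_ge0 ?integral_powR_ge0// -LpdistE poweR_EFin.
  by rewrite -powRrM mulfV// powRr1.
rewrite LpdistE; apply: gt0_ler_poweR => //.
- by rewrite invr_ge0 ltW.
- by rewrite in_itv/= integral_powR_ge0 leey.
- by rewrite in_itv/= leey andbT mule_ge0 ?lee_fin ?powR_ge0 ?integral_powR_ge0.
Qed.

Lemma Lpdist_leP U V (M : R) : 0 <= M ->
  (Lpdist U V <= M%:E)%E <->
  (\int[P]_w ((d (U w) (V w)) `^ p)%:E <= (M `^ p)%:E)%E.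
Proof.
move=> M0; rewrite -Lpdist_powR -poweR_EFin; split=> h.
  apply: gt0_ler_poweR => //; first exact: ltW.
  - by rewrite in_itv/= Lpdist_ge0 leey.
  - by rewrite in_itv/= leey lee_fin M0.
have : ((Lpdist U V `^ p) `^ p^-1 <= (M%:E `^ p) `^ p^-1)%E.
  apply: gt0_ler_poweR => //; first by rewrite invr_ge0 ltW.
  - by rewrite in_itv/= poweR_ge0 leey.
  - by rewrite in_itv/= lee_fin powR_ge0 leey.
by rewrite -!poweRrM mulfV// !poweRe1// Lpdist_ge0.
Qed.

Lemma measurable_powR_dist {dT} {T : measurableType dT} (U V : T -> E) :
  measurable_fun setT U -> measurable_fun setT V ->
  measurable_fun setT (fun w => ((d (U w) (V w)) `^ p)%:E).
Proof.
move=> mU mV; apply/measurable_EFinP.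
apply: (@measurableT_comp _ _ _ _ _ _ (@powR R ^~ p)) => //.
exact: measurable_fun_dist.
Qed.

(** The pointwise triangle inequality, followed by Minkowski for the real functions [d (U w) (V w)]
    and [d (V w) (W w)]. *)
Lemma Lpdist_triangle U V W : measurable_fun setT U -> measurable_fun setT V ->
  measurable_fun setT W -> (Lpdist U W <= Lpdist U V + Lpdist V W)%E.
Proof.
move=> mU mV mW.
have mUV := measurable_fun_dist dP _ _ mU mV.
have mVW := measurable_fun_dist dP _ _ mV mW.
apply: le_trans (minkowski_EFin P mUV mVW p1).
rewrite /Lpdist unlock; apply: gt0_ler_poweR => //.
- by rewrite invr_ge0 ltW.
- by rewrite in_itv/= leey andbT; apply: integral_ge0 => w _; rewrite lee_fin powR_ge0.
- by rewrite in_itv/= leey andbT; apply: integral_ge0 => w _; rewrite lee_fin powR_ge0.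
apply: ge0_le_integral => //.
- by move=> w _; exact: poweR_ge0.
- have := measurable_powR_dist _ _ mU mW; apply: eq_measurable_fun => w _.
  by rewrite abse_EFin ger0_norm.
- apply/measurable_EFinP.
  apply: (@measurableT_comp _ _ _ _ _ _ (@powR R ^~ p)) => //.
  by apply: measurableT_comp => //; exact: measurable_funD.
- move=> w _; rewrite !abse_EFin !poweR_EFin lee_fin !ger0_norm//=; last first.
    by rewrite addr_ge0.
  by apply: ge0_ler_powR; rewrite ?nnegrE ?addr_ge0// ltW.
Qed.

Lemma Lpdist_eq0 U V : measurable_fun setT U -> measurable_fun setT V ->
  Lpdist U V = 0%E -> {ae P, forall w, U w = V w}.
Proof.
move=> mU mV /Lnorm_eq0_eq0.
have mUV : measurable_fun setT (fun w => (d (U w) (V w))%:E).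
  by apply/measurable_EFinP; exact: measurable_fun_dist.
move=> /(_ mUV); rewrite lte_fin p0 => /(_ isT).
by apply: filterS => w /(_ I) /= [] /d_eq0.
Qed.

(** Almost surely [d (U w) (g n w)] tends to [d (U w) (X w)], hence so do the p-th powers, and Fatou
    carries the uniform bound over to the limit. *)
Lemma Lpdist_fatou U (g : nat -> Omega -> E) X (M : R) :
  measurable_fun setT U -> (forall n, measurable_fun setT (g n)) ->
  measurable_fun setT X -> 0 <= M ->
  (forall n, (Lpdist U (g n) <= M%:E)%E) ->
  {ae P, forall w, (fun n => d (g n w) (X w)) @ \oo --> 0} ->
  (Lpdist U X <= M%:E)%E.
Proof.
move=> mU mg mX M0 UgM gX; apply/Lpdist_leP => //.
pose f n w := ((d (U w) (g n w)) `^ p)%:E.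
have mf n : measurable_fun setT (f n) by exact: measurable_powR_dist.
have f0 n w : (0 <= f n w)%E by rewrite lee_fin powR_ge0.
have -> : (\int[P]_w ((d (U w) (X w)) `^ p)%:E =
    \int[P]_w limn_einf (f ^~ w))%E.
  apply: ge0_ae_eq_integral => //.
  - exact: measurable_powR_dist.
  - rewrite (_ : (fun w => _) = (fun w => limn_einf (f ^~ w)))//.
    under eq_fun do rewrite limn_einf_lim.
    apply: (emeasurable_fun_cvg (fun n w => einfs (f ^~ w) n)).
      by move=> n; exact: measurable_fun_einfs.
    by move=> w _; exact: is_cvg_einfs.
  - by move=> w _; rewrite lee_fin powR_ge0.
  - move=> w _; rewrite limn_einf_lim; apply: lime_ge; first exact: is_cvg_einfs.
    by apply: nearW => n; apply: le_ereal_inf_tmp => _ [k _ <-].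
  - apply: filterS gX => w gXw _.
    suff h : f ^~ w @ \oo --> ((d (U w) (X w)) `^ p)%:E.
      by rewrite (cvg_limn_einf_sup h).
    apply: cvg_EFin; first exact: nearW.
    apply: cvg_powR => //.
    apply/cvgrPdist_le => e e0; move/cvgrPdist_le : gXw => /(_ e e0).
    apply: filterS => n; rewrite sub0r normrN ger0_norm// => gXe.
    rewrite ler_norml; have := d_triangle (U w) (g n w) (X w).
    have := d_triangle (U w) (X w) (g n w); rewrite (dC (X w)).
    by move=> ? ?; apply/andP; split; lra.
apply: le_trans (fatou P measurableT mf (fun n w _ => f0 n w)) _.
rewrite limn_einf_lim; apply: lime_le; first exact: is_cvg_einfs.
apply: nearW => n; apply: (@le_trans _ _ (\int[P]_w f n w)%E).
  by apply: ereal_inf_lbound; exists n => /=.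
exact/Lpdist_leP.
Qed.

(* Pointwise, [y <= a + a^(1-p) y^p] for [y >= 0] and [a > 0]. *)
Lemma expectation_dist_le U V (a : R) :
  measurable_fun setT U -> measurable_fun setT V -> 0 < a ->
  (Lpdist U V <= a%:E)%E -> (\int[P]_w (d (U w) (V w))%:E <= (2 * a)%:E)%E.
Proof.
move=> mU mV a0 /(Lpdist_leP _ _ _ (ltW a0)) h.
have mD := measurable_powR_dist _ _ mU mV.
apply: (@le_trans _ _ (\int[P]_w (a%:E + (a `^ (1 - p))%:E * (d (U w) (V w) `^ p)%:E))%E).
  apply: ge0_le_integral => //.
  - by move=> w _; rewrite lee_fin.
  - by apply/measurable_EFinP; exact: measurable_fun_dist.
  - by apply: emeasurable_funD => //; exact: measurable_funeM.
  - move=> w _; rewrite -EFinM -EFinD lee_fin.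
    have [da|ad] := leP (d (U w) (V w)) a.
      by rewrite (le_trans da)// lerDl mulr_ge0// powR_ge0.
    have dUV0 : 0 < d (U w) (V w) by exact: lt_trans ad.
    apply: (@le_trans _ _ (a `^ (1 - p) * d (U w) (V w) `^ p)); last first.
      by rewrite lerDr ltW.
    (* Here [y = d (U w) (V w) > a]: write [y] as its p-th power divided by its (p-1)-th, and bound
       the latter below by that of [a]. *)
    rewrite -{1}(mulfK (lt0r_neq0 (powR_gt0 (p - 1) dUV0)) (d (U w) (V w))).
    rewrite mulr_powRB1// [leRHS]mulrC ler_wpM2l ?powR_ge0//.
    rewrite -(opprB p 1) powRN lef_pV2 ?posrE ?powR_gt0//.
    by apply: ge0_ler_powR; rewrite ?nnegrE ?subr_ge0 ?(ltW a0)// ltW.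
rewrite ge0_integralD//; last 3 first.
- by move=> w _; rewrite lee_fin ltW.
- by move=> w _; rewrite -EFinM lee_fin mulr_ge0 ?powR_ge0.
- exact: measurable_funeM.
have -> : (\int[P]_w a%:E = a%:E)%E.
  by rewrite integral_cst// -[RHS]mule1; congr (_ * _)%E; exact: probability_setT.
rewrite ge0_integralZl//; last 2 first.
- by move=> w _; rewrite lee_fin powR_ge0.
- by rewrite lee_fin powR_ge0.
apply: (@le_trans _ _ (a%:E + (a `^ (1 - p))%:E * (a `^ p)%:E)%E).
  by rewrite leeD2l// lee_pmul2l// ?lte_fin ?powR_gt0.
rewrite -EFinM -EFinD lee_fin -powRD ?subrK; last by rewrite (gt_eqF a0) implybT.
by rewrite powRr1 ?(ltW a0)// mulr_natl mulr2n.
Qed.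

End Lp_distance.

(** * Composition, time shift and measurability of the iterates *)

Section iterates.
Context {E E' Omega : Type} (F : E * E' -> E) (zeta : int -> Omega -> E').

Lemma fiter_tfiter n s x w :
  fiter F zeta n s x w = tfiter F (fun i => zeta (s + i%:Z) w) n x.
Proof. by elim: n => //= n ->. Qed.

Lemma fiter_add n k s x w :
  fiter F zeta (n + k) s x w =
  fiter F zeta k (s + n%:Z) (fiter F zeta n s x w) w.
Proof.
elim: k => [|k IH]; first by rewrite addn0.
by rewrite addnS /= IH PoszD addrA.
Qed.

(** Reduces iterates along [zeta] to those of the coordinate process on the noise path shifted by
    [t]; this makes the limit one functional common to all times. *)
Lemma fiter_shift n s t x w :
  fiter F zeta n (t + s) x w =
  fiter F (fun j (u : int -> E') => u j) n s x (fun j => zeta (t + j) w).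
Proof. by elim: n => //= n ->; rewrite addrA. Qed.

End iterates.

Section iterates_measurable.
Context {dT dE dE' : measure_display} {T : measurableType dT}
  {E : measurableType dE} {E' : measurableType dE'} (F : E * E' -> E).
Hypothesis mF : measurable_fun setT F.

(** Measurability is asked of the coordinates below [n] only, since [tupType E' m] provides it just
    for the first [m]. *)
Lemma measurable_tfiter (z : nat -> T -> E') n (U : T -> E) :
  (forall i, (i < n)%N -> measurable_fun setT (z i)) -> measurable_fun setT U ->
  measurable_fun setT (fun w => tfiter F (fun i => z i w) n (U w)).
Proof.
move=> + mU; elim: n => [//|n IH] mz /=.
apply: (measurableT_comp mF); apply: measurable_fun_pair; last exact: mz.
by apply: IH => i ni; apply: mz; rewrite ltnS ltnW.
Qed.

Lemma measurable_fiter (zeta : int -> T -> E') n s (U : T -> E) :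
  (forall i, (i < n)%N -> measurable_fun setT (zeta (s + i%:Z))) ->
  measurable_fun setT U ->
  measurable_fun setT (fun w => fiter F zeta n s (U w) w).
Proof.
move=> mz mU; under eq_fun do rewrite fiter_tfiter.
exact: (@measurable_tfiter (fun i => zeta (s + i%:Z))).
Qed.

End iterates_measurable.

(** * Contraction of the random iterates in L^p *)

Section contraction.
Context {R : realType} {dO dE dE' : measure_display}
  {Omega : measurableType dO} {P : probability Omega R}
  {E : measurableType dE} {d : E -> E -> R} {E' : measurableType dE'}
  {F : E * E' -> E} {Fl : int -> set (set Omega)} {zeta : int -> Omega -> E'}.
Hypotheses (dP : polish_space_with d) (mF : measurable_fun setT F)
  (FlP : filtration Fl) (Flzeta : forall t, meas_wrt (Fl t) (zeta t)).

Lemma meas_wrt_le s t (X : Omega -> E) : s <= t ->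
  meas_wrt (Fl s) X -> meas_wrt (Fl t) X.
Proof. by case: FlP => _ _ h st mX B mB; exact: (h _ _ st) (mX _ mB). Qed.

Lemma meas_wrt_measurable {dS} {S : measurableType dS} t (X : Omega -> S) :
  meas_wrt (Fl t) X -> measurable_fun setT X.
Proof.
by case: FlP => _ h _ mX _ B mB; rewrite setTI; exact: (h t) (mX _ mB).
Qed.

Lemma meas_wrt_cst t (x : E) : meas_wrt (Fl t) (fun=> x).
Proof. by case: FlP => h _ _; apply/meas_wrtP. Qed.

(** The [n] maps from time [s] use noise up to [s + n - 1], so the image is an admissible starting
    point for a block beginning at [s + n]. This is what allows blocks to be chained. *)
Lemma meas_wrt_fiter n s (U : Omega -> E) : meas_wrt (Fl (s - 1)) U ->
  meas_wrt (Fl (s + n%:Z - 1)) (fun w => fiter F zeta n s (U w) w).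
Proof.
case: FlP => sFl _ Flle mU.
apply/(meas_wrtP _ (sFl _)); apply: measurable_fiter => //.
- move=> i ni; apply/(meas_wrtP _ (sFl _)) => B mB.
  by apply: Flle (Flzeta _ _ mB); lia.
- by apply/(meas_wrtP _ (sFl _)) => B mB; apply: Flle (mU _ mB); lia.
Qed.

Context {p : R}.
Hypothesis p1 : 1 <= p.

Local Notation Lpd := (@Lpdist _ _ _ _ _ P d p).

(** Freezing [U] and [V] turns the p-th moment into an average of integrals against [K w], each
    bounded by hypothesis. With [n <= m] both inequalities of (A2) are instances: [n = 1] with [L],
    and [n = m] with [kappa]. *)
Lemma fiter_contract_block m n t (c : R)
    (K : Omega -> probability (tupType E' m) R) (U V : Omega -> E) :
  (n <= m)%N -> 0 <= c -> reg_cond_distr P (Fl (t - 1)) zeta t m K ->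
  {ae P, forall w, forall x y : E,
    (\int[K w]_z ((d (tfiter F z n x) (tfiter F z n y)) `^ p)%:E
      <= ((c `^ p) * (d x y `^ p))%:E)%E} ->
  meas_wrt (Fl (t - 1)) U -> meas_wrt (Fl (t - 1)) V ->
  (Lpd (fun w => fiter F zeta n t (U w) w) (fun w => fiter F zeta n t (V w) w)
    <= c%:E * Lpd U V)%E.
Proof.
move=> nm c0 [mK KP] KL mU mV; case: (FlP) => sFl Flm _.
have sG := sFl (t - 1); have Gm := Flm (t - 1).
pose Z (w : Omega) : tupType E' m := fun i => zeta (t + i%:Z) w.
have mZ : measurable_fun setT Z.
  apply: (@measurability _ _ Omega (tupType E' m) setT Z (tup_gen E' m) erefl).
  move=> _ [_ [i [B [im [mB ->]]]] <-].
  rewrite setTI; apply: (Flm (t + i%:Z)); exact: Flzeta.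
pose f (x : g_sigma_algebraType (Fl (t - 1)) * tupType E' m) :=
  ((d (tfiter F x.2 n (U x.1)) (tfiter F x.2 n (V x.1))) `^ p)%:E.
have f0 x : (0 <= f x)%E by rewrite lee_fin powR_ge0.
have mcoord i : (i < n)%N -> measurable_fun setT
    (fun x : g_sigma_algebraType (Fl (t - 1)) * tupType E' m => x.2 i).
  move=> ni; apply: (@measurableT_comp _ _ _ _ _ _
    (fun z : tupType E' m => z i) _ snd) => //.
  move=> _ B mB; rewrite setTI; apply: sub_sigma_algebra.
  by exists i, B; split => //; exact: leq_trans nm.
have mf : measurable_fun setT f.
  apply: measurable_powR_dist => //; apply: measurable_tfiter => //.
  - by apply: measurableT_comp => //; apply/meas_wrtP.
  - by apply: measurableT_comp => //; apply/meas_wrtP.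
have mU' := meas_wrt_measurable _ _ mU; have mV' := meas_wrt_measurable _ _ mV.
apply: Lpdist_lePow => //.
under eq_integral do rewrite !fiter_tfiter.
rewrite (freezing P (Fl (t - 1)) sG Gm Z mZ K mK KP f f0 mf).
rewrite -ge0_integralZl//; last 3 first.
- exact: measurable_powR_dist.
- by move=> w _; rewrite lee_fin powR_ge0.
- by rewrite lee_fin powR_ge0.
apply: ae_ge0_le_integral => //.
- by move=> w _; exact: integral_ge0.
- have := measurable_frozen_integral (Fl (t - 1)) sG K mK f f0 mf.
  by move=> h; exact: measurableT_comp h (measurable_sub_id _ sG Gm).
- by move=> w _; rewrite -EFinM lee_fin mulr_ge0 ?powR_ge0.
- by apply: measurable_funeM; exact: measurable_powR_dist.
(* The null set is common to all pairs of points, so the bound may be taken at the random pair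
   [U w], [V w]. *)
- by apply: filterS KL => w KLw _; rewrite -EFinM; exact: (KLw (U w) (V w)).
Qed.

Context {L kappa : R} {m : nat}.
Hypotheses (L0 : 0 < L) (kappa01 : 0 < kappa < 1) (m0 : (0 < m)%N).
Hypothesis A2 : forall t : int, exists K : Omega -> probability (tupType E' m) R,
  reg_cond_distr P (Fl (t - 1)) zeta t m K /\
  {ae P, forall w, forall x y : E,
    (\int[K w]_z ((d (F (x, z 0%N)) (F (y, z 0%N))) `^ p)%:E
        <= ((L `^ p) * (d x y `^ p))%:E)%E /\
    (\int[K w]_z ((d (tfiter F z m x) (tfiter F z m y)) `^ p)%:E
        <= ((kappa `^ p) * (d x y `^ p))%:E)%E}.

Let fit n s U := fun w : Omega => fiter F zeta n s (U w) w.

Let fit_step t U V : meas_wrt (Fl (t - 1)) U -> meas_wrt (Fl (t - 1)) V ->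
  (Lpd (fit 1 t U) (fit 1 t V) <= L%:E * Lpd U V)%E.
Proof.
move=> mU mV; have [K [rK KL]] := A2 t.
apply: (fiter_contract_block _ 1 t L K) => //; first exact: ltW.
by apply: filterS KL => w KLw x y; exact: (KLw x y).1.
Qed.

Let fit_block t U V : meas_wrt (Fl (t - 1)) U -> meas_wrt (Fl (t - 1)) V ->
  (Lpd (fit m t U) (fit m t V) <= kappa%:E * Lpd U V)%E.
Proof.
move=> mU mV; have [K [rK KL]] := A2 t.
apply: (fiter_contract_block _ m t kappa K) => //.
  by case/andP : kappa01 => /ltW.
by apply: filterS KL => w KLw x y; exact: (KLw x y).2.
Qed.

(** Induction that splits off the earliest block: its images are measurable just before the
    remaining [k] blocks start. *)
Let fit_iter b (c : R) : 0 <= c ->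
  (forall t U V, meas_wrt (Fl (t - 1)) U -> meas_wrt (Fl (t - 1)) V ->
    (Lpd (fit b t U) (fit b t V) <= c%:E * Lpd U V)%E) ->
  forall k t U V, meas_wrt (Fl (t - 1)) U -> meas_wrt (Fl (t - 1)) V ->
    (Lpd (fit (k * b) t U) (fit (k * b) t V) <= (c ^+ k)%:E * Lpd U V)%E.
Proof.
move=> c0 H; elim=> [|k IH] t U V mU mV; first by rewrite expr0 mul1e.
have fitS W : fit (k.+1 * b) t W = fit (k * b) (t + b%:Z) (fit b t W).
  by apply/funext => w; rewrite /fit mulSn fiter_add.
rewrite !fitS exprSr EFinM -muleA.
apply: (le_trans (IH _ _ _ _ _)); try exact: meas_wrt_fiter.
by apply: lee_wpmul2l; [rewrite lee_fin exprn_ge0|exact: H].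
Qed.

Let theta := kappa `^ (m%:R^-1).

Lemma rate_gt0 : 0 < theta.
Proof. by rewrite powR_gt0//; case/andP : kappa01. Qed.

Lemma rate_exp n : theta ^+ n = kappa `^ (n%:R / m%:R).
Proof. by rewrite -powR_mulrn ?(ltW rate_gt0)// -powRrM mulrC. Qed.

Lemma rate_lt1 : theta < 1.
Proof.
have thm : theta ^+ m = kappa.
  rewrite rate_exp divff ?pnatr_eq0 -?lt0n// powRr1//.
  by case/andP : kappa01 => /ltW.
rewrite ltNge; apply/negP => th1.
by have := exprn_ege1 m th1; rewrite thm leNgt; case/andP : kappa01 => _ ->.
Qed.

(** Write [n = q * m + r] with [r < m]. The first [r] maps cost at most [L ^+ r], and the [q] full
    blocks after them gain [kappa ^+ q]. *)
Lemma fiter_contraction : exists2 C : R, 0 < C &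
  forall n t U V, meas_wrt (Fl (t - 1)) U -> meas_wrt (Fl (t - 1)) V ->
  (Lpd (fun w => fiter F zeta n t (U w) w) (fun w => fiter F zeta n t (V w) w)
    <= (C * theta ^+ n)%:E * Lpd U V)%E.
Proof.
have th0 := rate_gt0; have th1 := rate_lt1.
have [k0 k1] := andP kappa01.
have thm : theta ^+ m = kappa.
  by rewrite rate_exp divff ?pnatr_eq0 -?lt0n// powRr1// ltW.
(* [Num.max 1 L ^+ m] dominates [L ^+ r] for every [r < m]; dividing by [kappa] pays for rounding
   [n / m] down to [q]. *)
pose C := Num.max 1 L ^+ m / kappa.
have C0 : 0 < C by rewrite divr_gt0// exprn_gt0// lt_max ltr01.
exists C => // n t U V mU mV.
set r := (n %% m)%N; set q := (n %/ m)%N.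
have fitn W : fit n t W = fit (q * m) (t + r%:Z) (fit (r * 1) t W).
  by apply/funext => w; rewrite /fit muln1 -fiter_add addnC -divn_eq.
rewrite -/(fit n t U) -/(fit n t V) !fitn.
apply: (le_trans (fit_iter m kappa (ltW k0) fit_block _ _ _ _ _ _)).
- by rewrite muln1; exact: meas_wrt_fiter.
- by rewrite muln1; exact: meas_wrt_fiter.
apply: (@le_trans _ _ ((kappa ^+ q)%:E * ((L ^+ r)%:E * Lpd U V))%E).
  apply: lee_wpmul2l; first by rewrite lee_fin exprn_ge0// ltW.
  exact: (fit_iter 1 L (ltW L0) fit_step).
rewrite muleA -EFinM; apply: lee_wpmul2r; first exact: Lpdist_ge0.
rewrite lee_fin.
have Lr : L ^+ r <= Num.max 1 L ^+ m.
  apply: (@le_trans _ _ (Num.max 1 L ^+ r)).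
    by apply: lerXn2r; rewrite ?nnegrE ?le_max ?ler01 ?(ltW L0)// lexx orbT.
  by apply: ler_weXn2l; [rewrite le_max lexx|rewrite ltnW ?ltn_pmod].
(* From [n < q.+1 * m] and [theta < 1]: [kappa ^+ q.+1 = theta ^+ (m * q.+1) <= theta ^+ n]. *)
have kq : kappa ^+ q <= kappa^-1 * theta ^+ n.
  rewrite ler_pdivlMl// -exprS -thm -exprM.
  apply: ler_wiXn2l; rewrite ?(ltW th0) ?(ltW th1)//.
  by rewrite mulnC ltnW// ltn_ceil.
rewrite mulrC /C -mulrA.
by apply: ler_pM => //; rewrite exprn_ge0// ltW.
Qed.

End contraction.

(** * Metric limits as total measurable functions *)

Section metric_limit.
Context {R : realType} {dE : measure_display} {E : measurableType dE}
  {d : E -> E -> R}.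
Hypothesis dP : polish_space_with d.

Let d_ge0 x y : 0 <= d x y. Proof. by case: dP => -[[]]. Qed.
Let dC x y : d x y = d y x. Proof. by case: dP => -[[]]. Qed.
Let d_triangle x y z : d x z <= d x y + d y z.
Proof. by case: dP => -[[]]. Qed.

Definition dcvg (u : nat -> E) (l : E) :=
  forall e : R, 0 < e -> exists N, forall n, (N <= n)%N -> d (u n) l < e.

Definition dcauchy (u : nat -> E) :=
  forall e : R, 0 < e -> exists N, forall n k, (N <= n)%N -> (N <= k)%N ->
    d (u n) (u k) < e.

(** The default [x0] makes the limit total, so that identities between limits can hold on every path
    and not merely almost surely. *)
Definition dlim (x0 : E) (u : nat -> E) : E := xget x0 (dcvg u).

Lemma dlimP x0 u : dcauchy u -> dcvg u (dlim x0 u).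
Proof.
case: dP => -[_ _ dcompl] _ /dcompl[l ul].
by rewrite /dlim; case: xgetP => [l' _ //|/(_ l)].
Qed.

Lemma dcvg_dcauchy u l : dcvg u l -> dcauchy u.
Proof.
move=> ul e e0; have [N Nl] := ul (e / 2) (ltac:(by rewrite divr_gt0)).
exists N => n k Nn Nk; have := d_triangle (u n) l (u k).
by have := Nl n Nn; have := Nl k Nk; rewrite (dC l); lra.
Qed.

Lemma dlim_default x0 u : ~ dcauchy u -> dlim x0 u = x0.
Proof.
by move=> nu; rewrite /dlim; case: xgetP => [l' _ /dcvg_dcauchy//|].
Qed.

(** The tolerances [1/(j+1)] suffice, which makes the Cauchy condition a countable combination of
    measurable events. *)
Lemma measurable_dcauchy {dT} {T : measurableType dT} (g : nat -> T -> E) :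
  (forall n, measurable_fun setT (g n)) ->
  measurable [set w | dcauchy (g ^~ w)].
Proof.
move=> mg.
rewrite (_ : [set _ | _] = \bigcap_j \bigcup_N
    \bigcap_(n in [set n | (N <= n)%N]) \bigcap_(k in [set k | (N <= k)%N])
    [set w | d (g n w) (g k w) < j.+1%:R^-1]).
  apply: bigcapT_measurable => j; apply: bigcupT_measurable => N.
  apply: bigcap_measurableType => n _; apply: bigcap_measurableType => k _.
  rewrite -[X in measurable X]setTI.
  rewrite (_ : [set _ | _] = (fun w => d (g n w) (g k w)) @^-1` `]-oo, j.+1%:R^-1[).
    exact: measurable_fun_dist.
  by apply/seteqP; split => w /=; rewrite in_itv.
apply/seteqP; split => w /=.
- move=> gw j _; have [N HN] := gw j.+1%:R^-1 (ltac:(by rewrite invr_gt0 ltr0n)).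
  by exists N => // n /= Nn k /= Nk; exact: HN.
- move=> gw e e0.
  have [j _ /(_ j (leqnn j))/= je] := near_infty_natSinv_lt (PosNum e0).
  have [N _ HN] := gw j I; exists N => n k Nn Nk.
  exact: lt_trans (HN n Nn k Nk) je.
Qed.

(** Replacing the sequence by the constant [x0] wherever it is not Cauchy gives measurable maps that
    converge to [dlim] everywhere. *)
Lemma measurable_dlim x0 {dT} {T : measurableType dT} (g : nat -> T -> E) :
  (forall n, measurable_fun setT (g n)) ->
  measurable_fun setT (fun w => dlim x0 (g ^~ w)).
Proof.
move=> mg; have mA := measurable_dcauchy _ mg.
pose h n w := if w \in [set w | dcauchy (g ^~ w)] then g n w else x0.
apply: (measurable_fun_dlim dP h).
  move=> n; apply: measurable_fun_ifT => //.
  by apply: (measurable_fun_bool true); rewrite setTI preimage_mem_true.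
move=> w e e0; have [cw|ncw] := pselect (dcauchy (g ^~ w)).
  have [N HN] := dlimP x0 _ cw _ e0; exists N => n Nn.
  by rewrite /h mem_set//; exact: HN.
exists 0%N => n _; rewrite dlim_default// /h memNset//.
by case: dP => -[[_ d0 _ _] _ _] _; rewrite (d0 _ _).2.
Qed.

(** The partial sums [s] of the increments satisfy [d (u n) (u k) <= s k - s n] for [n <= k]; being
    monotone and bounded by the total sum, they converge. *)
Lemma summable_dcauchy (u : nat -> E) :
  (\sum_(0 <= n <oo) (d (u n) (u n.+1))%:E < +oo)%E -> dcauchy u.
Proof.
set S := (\sum_(0 <= n <oo) _)%E => Soo.
have Sfin : S \is a fin_num.
  by rewrite ge0_fin_numE//; apply: nneseries_ge0 => n _ _; rewrite lee_fin.
pose s := series (fun n => d (u n) (u n.+1)).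
have ds n k : d (u n) (u (n + k)%N) <= s (n + k)%N - s n.
  elim: k => [|k IH].
    rewrite addn0 subrr.
    by case: dP => -[[_ d0 _ _] _ _] _; rewrite (d0 _ _).2.
  rewrite addnS (le_trans (d_triangle _ (u (n + k)%N) _))//.
  by rewrite /s seriesSr -/(s _) [leRHS]addrAC lerD2r.
have nds : nondecreasing_seq s.
  by move=> n k nk; rewrite -subr_ge0 -(subnKC nk); exact: le_trans (ds _ _).
have cs : cvgn s.
  apply: nondecreasing_is_cvgn => //; exists (fine S) => _ [n _ <-].
  rewrite -lee_fin fineK// /s /series/= -sumEFin.
  by apply: nneseries_lim_ge => k _ _; rewrite lee_fin.
move=> e e0.
have /cvgrPdist_lt/(_ (e / 2) (divr_gt0 e0 (ltr0n R 2)))[N _ HN] := cs.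
exists N.
have H n k : (N <= n)%N -> (n <= k)%N -> d (u n) (u k) < e.
  move=> Nn nk; have := ds n (k - n)%N; rewrite subnKC//.
  have := HN n Nn; have := HN k (leq_trans Nn nk) => /=.
  by rewrite !ltr_norml => /andP[? ?] /andP[? ?]; lra.
move=> n k Nn Nk; have [nk|/ltnW kn] := leqP n k; first exact: H.
by rewrite dC; exact: H.
Qed.

End metric_limit.

Lemma geometric_bound_eq0 {R : realType} (a : \bar R) (C theta : R) :
  0 <= theta < 1 -> (0 <= a)%E -> (forall n, (a <= (C * theta ^+ n)%:E)%E) ->
  a = 0%E.
Proof.
move=> /andP[th0 th1] + aC; case: a aC => [r aC|/(_ 0%N)//|//].
rewrite lee_fin => r0; congr EFin; apply/eqP; rewrite eq_le r0 andbT.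
have rC n : r <= C * theta ^+ n by rewrite -lee_fin.
have Cth : (fun n => C * theta ^+ n) @ \oo --> C * 0.
  by apply: cvgMr; apply: cvg_expr; rewrite ger0_norm.
by rewrite -(mulr0 C); apply: (cvgr_to_ge Cth); exact: nearW.
Qed.

(** * The limit as a shift-equivariant functional of the noise path *)

Section canonical_process.
Context {R : realType} {dE dE' : measure_display}
  {E : measurableType dE} (d : E -> E -> R) {E' : measurableType dE'}
  (F : E * E' -> E) (x0 : E).
Hypotheses (dP : polish_space_with d) (mF : measurable_fun setT F).

(** The [n.+1] maps run from time [-n] to time [0] inclusive, for the coordinate process; the limit
    thus depends on the path up to time [0], and [X_t] is its value on the path re-centred at
    [t]. *)
Definition orbit_limit (x : E) (u : int -> E') : E :=
  @dlim _ _ _ d x0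
    (fun n => fiter F (fun j (v : int -> E') => v j) n.+1 (- n%:Z) x u).

Definition canonical_path (x : E) (u : int -> E') : int -> E * E' :=
  fun t => (orbit_limit x (fun j => u (t + j)), u t).

Local Notation path_space := (g_sigma_algebraType (cyl_gen E')).

Let mcoord t : measurable_fun setT ((fun u => u t) : path_space -> E').
Proof.
by move=> _ B mB; rewrite setTI; apply: sub_sigma_algebra; exists t, B.
Qed.

Lemma measurable_path {dT} {T : measurableType dT} (z : int -> T -> E') :
  (forall t, measurable_fun setT (z t)) ->
  measurable_fun setT ((fun w t => z t w) : T -> path_space).
Proof.
move=> mz; apply: (@measurability _ _ T path_space setT _ (cyl_gen E') erefl).
move=> _ [_ [t [B [mB ->]]] <-]; exact: mz.
Qed.

Lemma measurable_orbit_limit x :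
  measurable_fun setT (orbit_limit x : path_space -> E).
Proof.
apply: measurable_dlim => // n.
apply: (@measurable_fiter _ _ _ path_space _ _ F mF (fun j v => v j) _ _ (fun=> x)) => //.
Qed.

Lemma measurable_canonical_path x (A : set (int -> E * E')) :
  cyl_sigma (E * E')%type A -> cyl_sigma E' (canonical_path x @^-1` A).
Proof.
move=> cA.
suff : measurable_fun setT (canonical_path x : path_space ->
    g_sigma_algebraType (cyl_gen (E * E')%type)).
  by move=> /(_ measurableT A cA); rewrite setTI.
apply: (@measurability _ _ path_space (g_sigma_algebraType (cyl_gen (E * E')%type))
  setT _ (cyl_gen (E * E')%type) erefl).
move=> _ [_ [t [B [mB ->]]] <-].
suff mt : measurable_fun setT ((fun u => canonical_path x u t) : path_space -> E * E').
  exact: mt.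
apply: measurable_fun_pair => //.
have mt : measurable_fun setT ((fun u j => u (t + j)) : path_space -> path_space).
  exact: (measurable_path (fun j (u : path_space) => u (t + j))).
exact: measurableT_comp (measurable_orbit_limit x) mt.
Qed.

(** Re-centring at [t + 1] is re-centring the shifted path at [t]. The identity holds on every path,
    so no exceptional set intervenes in the transfer of stationarity and ergodicity. *)
Lemma canonical_path_shift x u :
  shift1 (canonical_path x u) = canonical_path x (shift1 u).
Proof.
apply/funext => t; rewrite /shift1 /canonical_path; congr (orbit_limit _ _, _).
by apply/funext => j; rewrite addrAC.
Qed.

Context {dO : measure_display} {Omega : measurableType dO}
  (P : probability Omega R) (zeta : int -> Omega -> E').

Let X x t w := orbit_limit x (fun j => zeta (t + j) w).

(** An event of the pair process is the event of the noise obtained by pulling back along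
    [canonical_path x]; equivariance carries the shift across. *)
Lemma stationary_orbit_limit x :
  stationary P zeta -> stationary P (fun t w => (X x t w, zeta t w)).
Proof.
move=> sz A cA.
have := sz _ (measurable_canonical_path x A cA).
under [in X in _ = X -> _]eq_set do rewrite /= -canonical_path_shift.
exact.
Qed.

(** By equivariance the pullback of a shift-invariant event is again shift-invariant. *)
Lemma ergodic_orbit_limit x :
  ergodic P zeta -> ergodic P (fun t w => (X x t w, zeta t w)).
Proof.
move=> [sz ez]; split; first exact: stationary_orbit_limit.
move=> A cA AS; apply: (ez _ (measurable_canonical_path x A cA)) => u /=.
by rewrite -canonical_path_shift; exact: AS.
Qed.

End canonical_process.

(** * Convergence of the pullback iterates and identification of their limit *)

Section pullback_convergence.
Context {R : realType} {dO dE dE' : measure_display}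
  {Omega : measurableType dO} (P : probability Omega R)
  {E : measurableType dE} (d : E -> E -> R) {E' : measurableType dE'}
  (F : E * E' -> E) {Fl : int -> set (set Omega)} (zeta : int -> Omega -> E')
  {p C0 C1 theta : R} (x0 : E).
Hypotheses (dP : polish_space_with d) (mF : measurable_fun setT F)
  (FlP : filtration Fl) (Flzeta : forall t, meas_wrt (Fl t) (zeta t))
  (p1 : 1 <= p) (th0 : 0 < theta) (th1 : theta < 1) (C0_gt0 : 0 < C0).

Local Notation Lpd := (@Lpdist _ _ _ _ _ P d p).

Hypothesis A1 : forall t : int,
  (\int[P]_w ((d (F (x0, zeta t w)) x0) `^ p)%:E <= C1%:E)%E.
Hypothesis contr : forall n t (U V : Omega -> E),
  meas_wrt (Fl (t - 1)) U -> meas_wrt (Fl (t - 1)) V ->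
  (Lpd (fun w => fiter F zeta n t (U w) w) (fun w => fiter F zeta n t (V w) w)
    <= (C0 * theta ^+ n)%:E * Lpd U V)%E.

Let d_ge0 x y : 0 <= d x y. Proof. by case: dP => -[[]]. Qed.
Let dC x y : d x y = d y x. Proof. by case: dP => -[[]]. Qed.
Let d_eq0 x y : d x y = 0 <-> x = y. Proof. by case: dP => -[[]]. Qed.
Let p0 : 0 < p. Proof. exact: lt_le_trans p1. Qed.

Let mzeta t : measurable_fun setT (zeta t).
Proof. exact: (meas_wrt_measurable FlP t (zeta t) (Flzeta t)). Qed.

Let mfit n t x : measurable_fun setT (fiter F zeta n t x).
Proof. exact: (@measurable_fiter _ _ _ _ _ _ F mF zeta n t (fun=> x)). Qed.

Lemma Lpdist_moment (U : Omega -> E) (C : R) :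
  (\int[P]_w ((d (U w) x0) `^ p)%:E <= C%:E)%E ->
  (Lpd U (fun=> x0) <= (Num.max C 0 `^ p^-1)%:E)%E.
Proof.
move=> UC; apply/Lpdist_leP; rewrite ?powR_ge0// -powRrM mulVf ?gt_eqF//.
have M0 : 0 <= Num.max C 0 by rewrite le_max lexx orbT.
by rewrite powRr1// (le_trans UC)// lee_fin le_max lexx.
Qed.

Lemma Lpdist_cst x y : (Lpd (fun=> x) (fun=> y) <= (d x y)%:E)%E.
Proof.
apply/Lpdist_leP => //; rewrite integral_cst//.
by rewrite [X in (_ * X)%E](_ : _ = 1%E) ?mule1//; exact: probability_setT.
Qed.

Let pullback x (t : int) (n : nat) : Omega -> E :=
  fiter F zeta n.+1 (t - n%:Z) x.

Let X x t w := orbit_limit d F x0 x (fun j => zeta (t + j) w).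

(** Route from [x] through [x0] and [f_t(x0)] to [f_t(x)]: the middle leg is (A1), the last one is
    the contraction estimate for a single map. *)
Lemma Lpdist_one_step x : exists2 M : R, 0 < M &
  forall t, (Lpd (fun=> x) (fiter F zeta 1 t x) <= M%:E)%E.
Proof.
pose M0 := Num.max C1 0 `^ p^-1.
(* The final [1] only makes the constant strictly positive. *)
exists (d x x0 + (M0 + C0 * theta ^+ 1 * d x x0) + 1) => [|t].
  by rewrite ltr_wpDl// !addr_ge0 ?powR_ge0// !mulr_ge0 ?exprn_ge0// ltW.
have mcst (y : E) : measurable_fun setT (fun _ : Omega => y) by [].
apply: (@le_trans _ _ (d x x0 + (M0 + C0 * theta ^+ 1 * d x x0))%:E); last first.
  by rewrite lee_fin lerDl.
apply: (le_trans (Lpdist_triangle P dP p1 _ _ _ (mcst x) (mcst x0) (mfit 1 t x))).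
rewrite EFinD; apply: leeD; first exact: Lpdist_cst.
apply: (le_trans (Lpdist_triangle P dP p1 _ _ _ (mcst x0) (mfit 1 t x0) (mfit 1 t x))).
rewrite EFinD; apply: leeD.
  by rewrite LpdistC//; apply: Lpdist_moment; rewrite /= addr0.
have cw (y : E) := meas_wrt_cst FlP (t - 1) y.
apply: (@le_trans _ _ ((C0 * theta ^+ 1)%:E * Lpd (fun=> x0) (fun=> x))%E).
  exact: (contr 1 t _ _ (cw x0) (cw x)).
rewrite [leRHS]EFinM; apply: lee_wpmul2l; last by rewrite dC; exact: Lpdist_cst.
by rewrite lee_fin mulr_ge0 ?exprn_ge0// ltW.
Qed.

Lemma Lpdist_pullback_succ x : exists2 B : R, 0 < B &
  forall t n, (Lpd (pullback x t n) (pullback x t n.+1) <= (B * theta ^+ n)%:E)%E.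
Proof.
have [M M0 xM] := Lpdist_one_step x.
exists (C0 * M) => [|t n]; first exact: mulr_gt0.
(* The extra, earliest map is absorbed into the starting point, leaving the same [n.+1] maps on both
   sides. *)
have -> : pullback x t n.+1 = fun w => fiter F zeta n.+1 (t - n%:Z)
    (fiter F zeta 1 (t - n.+1%:Z) x w) w.
  apply/funext => w; rewrite /pullback -[n.+2]add1n fiter_add.
  by congr (fiter _ _ _ _ _ _); lia.
apply: (@le_trans _ _ ((C0 * theta ^+ n.+1)%:E *
    Lpd (fun=> x) (fiter F zeta 1 (t - n.+1%:Z) x))%E).
  apply: (contr n.+1 (t - n%:Z) (fun=> x) (fiter F zeta 1 (t - n.+1%:Z) x)).
    exact: (meas_wrt_cst FlP).
  have := meas_wrt_fiter mF FlP Flzeta 1%N (t - n.+1%:Z) (fun=> x)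
    (meas_wrt_cst FlP _ x).
  by apply: meas_wrt_le => //; lia.
apply: (@le_trans _ _ ((C0 * theta ^+ n.+1)%:E * M%:E)%E).
  by apply: lee_wpmul2l => //; rewrite lee_fin mulr_ge0 ?exprn_ge0 ?(ltW th0)// ltW.
rewrite -EFinM lee_fin [leRHS]mulrAC ler_pM2r//.
by rewrite ler_pM2l// exprS ger_pMl ?exprn_gt0// ltW.
Qed.

(** Geometric summation of the increments, with a bound uniform in [k] so that [k] can later tend to
    infinity. *)
Lemma Lpdist_pullback x : exists2 B : R, 0 < B &
  forall t n k, (Lpd (pullback x t n) (pullback x t (n + k)) <=
    (B * theta ^+ n)%:E)%E.
Proof.
have [B B0 gB] := Lpdist_pullback_succ x.
have omth : 0 < 1 - theta by rewrite subr_gt0.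
exists (B / (1 - theta)) => [|t n k]; first exact: divr_gt0.
elim: k n => [|k IH] n.
  rewrite addn0 (le_trans (_ : _ <= 0%:E)%E)//.
    apply/Lpdist_leP => //; rewrite powR0 ?gt_eqF//.
    rewrite (eq_integral (cst 0%E)) ?integral0// => w _.
    by rewrite (d_eq0 _ _).2// powR0 ?gt_eqF.
  by rewrite lee_fin mulr_ge0 ?exprn_ge0 ?(ltW th0)// divr_ge0 ?ltW.
apply: (le_trans (Lpdist_triangle P dP p1 _ (pullback x t n.+1) _ _ _ _)); try exact: mfit.
rewrite addnS -addSn; apply: (le_trans (leeD (gB t n) (IH n.+1))).
rewrite -EFinD lee_fin exprS.
(* The constant is a fixed point of the recursion: [B + theta * (B / (1 - theta)) = B / (1 -
   theta)]. *)
rewrite [X in X <= _](_ : _ = B / (1 - theta) * theta ^+ n)//.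
by field; rewrite gt_eqF.
Qed.

(** The total length of the pullback sequence has finite expectation, hence is almost surely
    finite. *)
Lemma ae_dcauchy_pullback x t : {ae P, forall w, dcauchy (d := d) (pullback x t ^~ w)}.
Proof.
have [B B0 gB] := Lpdist_pullback_succ x.
pose D n w := (d (pullback x t n w) (pullback x t n.+1 w))%:E.
have mD n : measurable_fun setT (D n).
  by apply/measurable_EFinP; apply: measurable_fun_dist => //; exact: mfit.
have D0 n w : (0 <= D n w)%E by rewrite lee_fin.
have intD : (\int[P]_w \sum_(0 <= n <oo) D n w < +oo)%E.
  rewrite integral_nneseries//.
  apply: (@le_lt_trans _ _ (\sum_(0 <= n <oo) (2 * B * theta ^+ n)%:E)%E).
    apply: lee_nneseries => n *; first exact: integral_ge0.
    (* The L^p bound on an increment becomes a first-moment bound at the price of a factor [2]. *)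
    rewrite -mulrA; apply: (expectation_dist_le P dP p1) => //; try exact: mfit.
    by rewrite mulr_gt0// exprn_gt0.
  have B20 : 0 <= 2 * B by rewrite mulr_ge0// ltW.
  have geo0 n : (0 <= (2 * B * theta ^+ n)%:E)%E.
    by rewrite lee_fin mulr_ge0 ?exprn_ge0// ltW.
  apply: le_lt_trans (ltry (2 * B / (1 - theta))).
  apply: lime_le; first by apply: is_cvg_nneseries => n _ _.
  apply: nearW => n; rewrite sumEFin lee_fin.
  by apply: geometric_le_lim; rewrite ?ger0_norm// ltW.
have : P.-integrable setT (fun w => \sum_(0 <= n <oo) D n w)%E.
  apply/integrableP; split; first by apply: ge0_emeasurable_sum => // n _.
  by under eq_integral do rewrite gee0_abs ?nneseries_ge0//.
move=> /integrable_ae => /(_ measurableT).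
apply: filterS => w /(_ I) Dw; apply: summable_dcauchy => //.
by rewrite ltey_eq Dw.
Qed.

Lemma orbit_limitE x t w :
  X x t w = @dlim _ _ _ d x0 (pullback x t ^~ w).
Proof.
rewrite /X /orbit_limit; congr (dlim _ _); apply/funext => n.
by rewrite /pullback fiter_shift.
Qed.

Lemma ae_dcvg_pullback x t :
  {ae P, forall w, dcvg (d := d) (pullback x t ^~ w) (X x t w)}.
Proof.
apply: filterS (ae_dcauchy_pullback x t) => w cw.
by rewrite orbit_limitE; exact: dlimP.
Qed.

Lemma ae_cvg_pullback x t : {ae P, forall w,
  (fun n => d (pullback x t n w) (X x t w)) @ \oo --> 0}.
Proof.
apply: filterS (ae_dcvg_pullback x t) => w cw; apply/cvgrPdist_lt => e e0.
have [N HN] := cw e e0; exists N => // n /= Nn.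
by rewrite sub0r normrN ger0_norm//; exact: HN.
Qed.

Lemma measurable_stationary x t : measurable_fun setT (X x t).
Proof.
have mz : measurable_fun setT ((fun w j => zeta (t + j) w) :
    Omega -> g_sigma_algebraType (cyl_gen E')).
  exact: (measurable_path (fun j => zeta (t + j))).
exact: measurableT_comp (measurable_orbit_limit d F x0 dP mF x) mz.
Qed.

(** Fatou along [k] in the bound between the iterates [n] and [n + k], which does not depend on
    [k]. *)
Lemma Lpdist_pullback_limit x : exists2 B : R, 0 < B &
  forall t n, (Lpd (pullback x t n) (X x t) <= (B * theta ^+ n)%:E)%E.
Proof.
have [B B0 gB] := Lpdist_pullback x; exists B => // t n.
apply: (Lpdist_fatou P dP p1 _ (fun k => pullback x t (n + k)%N)).
- exact: mfit.
- by move=> k; exact: mfit.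
- exact: measurable_stationary.
- by rewrite mulr_ge0 ?exprn_ge0// ltW.
- by move=> k; exact: gB.
- apply: filterS (ae_cvg_pullback x t) => w cw.
  under eq_cvg do rewrite addnC.
  by move: cw; rewrite -(cvg_shiftn n).
Qed.

Lemma Lpdist_stationary_bounded x : exists C : R,
  forall t, (Lpd (X x t) (fun=> x0) <= C%:E)%E.
Proof.
have [B B0 gB] := Lpdist_pullback_limit x; have [M M0 xM] := Lpdist_one_step x.
have mcst (y : E) : measurable_fun setT (fun _ : Omega => y) by [].
exists (B * theta ^+ 0 + (M + d x x0)) => t.
have mX := measurable_stationary x t.
(* The iterate with index [0] is already one map, [f_t(x)]; it links [X x t] to [x], and then to
   [x0]. *)
apply: (le_trans (Lpdist_triangle P dP p1 _ _ _ mX (mfit 1 (t - 0%:Z) x) (mcst x0))).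
rewrite EFinD; apply: leeD; first by rewrite LpdistC//; exact: (gB t 0%N).
apply: (le_trans (Lpdist_triangle P dP p1 _ _ _ (mfit 1 (t - 0%:Z) x) (mcst x) (mcst x0))).
rewrite EFinD; apply: leeD; last exact: Lpdist_cst.
by rewrite LpdistC//; exact: xM.
Qed.

(** Common source of the independence of the starting point and of the uniqueness of solutions: the
    distance to [X x t] is at most [(B + B') * theta ^+ n] for every [n], hence zero. *)
Lemma pullback_limit_unique x t (U : Omega -> E) (B : R) :
  measurable_fun setT U ->
  (forall n, (Lpd U (pullback x t n) <= (B * theta ^+ n)%:E)%E) ->
  {ae P, forall w, U w = X x t w}.
Proof.
move=> mU UB; have [B' B'0 gB] := Lpdist_pullback_limit x.
have mX := measurable_stationary x t.
apply: (Lpdist_eq0 P dP p1) => //.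
apply: (geometric_bound_eq0 _ (B + B') theta); first by rewrite th1 ltW.
  exact: Lpdist_ge0.
move=> n; have mg : measurable_fun setT (pullback x t n) by exact: mfit.
apply: (le_trans (Lpdist_triangle P dP p1 _ _ _ mU mg mX)).
by rewrite mulrDl EFinD; exact: leeD.
Qed.

(** One factor [theta] is given up so that the [n.+1] maps of the [n]-th pullback come with the rate
    [theta ^+ n]. *)
Lemma contr_moment n t (U : Omega -> E) (x : E) (C : R) :
  meas_wrt (Fl (t - 1)) U -> (Lpd U (fun=> x) <= C%:E)%E -> 0 <= C ->
  (Lpd (fun w => fiter F zeta n.+1 t (U w) w) (fiter F zeta n.+1 t x) <=
    (C0 * C * theta ^+ n)%:E)%E.
Proof.
move=> mU UC C_ge0.
apply: (@le_trans _ _ ((C0 * theta ^+ n.+1)%:E * Lpd U (fun=> x))%E).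
  by apply: (contr n.+1 t U (fun=> x)) => //; exact: (meas_wrt_cst FlP).
apply: (@le_trans _ _ ((C0 * theta ^+ n.+1)%:E * C%:E)%E).
  by apply: lee_wpmul2l => //; rewrite lee_fin mulr_ge0 ?exprn_ge0 ?(ltW th0)// ltW.
rewrite -EFinM lee_fin [leRHS]mulrAC ler_wpM2r//.
by rewrite ler_pM2l// exprS ger_pMl ?exprn_gt0// ltW.
Qed.

Lemma stationary_start_indep x y t : P [set w | X x t w <> X y t w] = 0%E.
Proof.
have mX := measurable_stationary x t; have mY := measurable_stationary y t.
have [B B0 gB] := Lpdist_pullback_limit x.
have XY : {ae P, forall w, X x t w = X y t w}.
  (* [B] accounts for the distance of [X x t] to its own pullback, [C0 * d x y] for that between the
     pullbacks of [x] and [y]. *)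
  apply: (pullback_limit_unique y t (X x t) (B + C0 * d x y)) => // n.
  have mx : measurable_fun setT (pullback x t n) by exact: mfit.
  have my : measurable_fun setT (pullback y t n) by exact: mfit.
  apply: (le_trans (Lpdist_triangle P dP p1 _ _ _ mX mx my)).
  rewrite mulrDl EFinD; apply: leeD; first by rewrite LpdistC.
  apply: (contr_moment n (t - n%:Z) (fun=> x) y); rewrite ?Lpdist_cst//.
  exact: (meas_wrt_cst FlP).
(* A negligible set has probability zero once it is measurable; here it is the event where the
   distance is nonzero. *)
apply/negligibleP; last exact: XY.
rewrite (_ : [set _ | _] = setT `&` (fun w => d (X x t w) (X y t w)) @^-1` (~` [set 0])).
  by apply: measurable_fun_dist => //; exact: measurableC.
by rewrite setTI; apply/seteqP; split => w /= h; apply: contra_not h => /d_eq0.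
Qed.

(** [Y t] is the image of [Y (t - n - 1)] under the [n.+1] maps of the pullback. Being
    non-anticipative, that starting point is admissible for the contraction, and its distance to [x]
    is bounded uniformly in time. *)
Lemma solution_unique (Y : int -> Omega -> E) (C : R) :
  (forall t, meas_wrt (Fl t) (Y t)) ->
  (forall t w, Y t w = F (Y (t - 1) w, zeta t w)) ->
  (forall j, (\int[P]_w ((d (Y j w) x0) `^ p)%:E <= C%:E)%E) ->
  forall x t, {ae P, forall w, Y t w = X x t w}.
Proof.
move=> mY YF YC x t.
have Yfiter n s w : Y (s - 1 + n%:Z) w = fiter F zeta n s (Y (s - 1) w) w.
  elim: n => [|n IH]; first by rewrite addr0.
  rewrite YF /=; congr (F (_, zeta _ w)); last by lia.
  by rewrite -IH; congr (Y _ w); lia.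
(* A bound, uniform in [j], for the L^p distance of [Y j] to [x], going through [x0]. *)
pose M := Num.max C 0 `^ p^-1 + d x0 x.
apply: (pullback_limit_unique x t (Y t) (C0 * M)) => [|n].
  exact: (meas_wrt_measurable FlP t (Y t) (mY t)).
have -> : Y t = fun w => fiter F zeta n.+1 (t - n%:Z) (Y (t - n%:Z - 1) w) w.
  by apply/funext => w; rewrite -Yfiter; congr (Y _ w); lia.
apply: contr_moment => //; last by rewrite addr_ge0// powR_ge0.
have mcst (y : E) : measurable_fun setT (fun _ : Omega => y) by [].
have mY' := meas_wrt_measurable FlP _ _ (mY (t - n%:Z - 1)).
apply: (le_trans (Lpdist_triangle P dP p1 _ _ _ mY' (mcst x0) (mcst x))).
rewrite EFinD; apply: leeD; last exact: Lpdist_cst.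
exact: Lpdist_moment.
Qed.

End pullback_convergence.

Theorem theorem2 (R : realType) (dO dE dE' : measure_display)
  (Omega : measurableType dO) (P : probability Omega R)
  (E : measurableType dE) (d : E -> E -> R) (E' : measurableType dE')
  (F : E * E' -> E) (Fl : int -> set (set Omega)) (zeta : int -> Omega -> E')
  (p L kappa : R) (m : nat) (x0 : E) :
  polish_space_with d ->
  @polish_space R _ E' ->
  measurable_fun setT F ->
  filtration Fl ->
  (forall t, meas_wrt (Fl t) (zeta t)) ->
  1 <= p -> 0 < L -> 0 < kappa < 1 -> (0 < m)%N ->
  (* (A1) *)
  (exists C : R, forall t : int,
      (\int[P]_w ((d (F (x0, zeta t w)) x0) `^ p)%:E <= C%:E)%E) ->
  (* (A2), through a regular conditional distribution K of
     (zeta_t, ..., zeta_{t+m-1}) given F_{t-1} *)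
  (forall t : int, exists K : Omega -> probability (tupType E' m) R,
     reg_cond_distr P (Fl (t - 1)) zeta t m K /\
     {ae P, forall w, forall x y : E,
        (\int[K w]_z ((d (F (x, z 0%N)) (F (y, z 0%N))) `^ p)%:E
            <= ((L `^ p) * (d x y `^ p))%:E)%E /\
        (\int[K w]_z ((d (tfiter F z m x) (tfiter F z m y)) `^ p)%:E
            <= ((kappa `^ p) * (d x y `^ p))%:E)%E}) ->
  exists X : E -> int -> Omega -> E,
   (* 1. *)
   (forall x t, measurable_fun setT (X x t)) /\
   (forall x, exists C : R, forall t : int,
      ('N[P]_(p%:E)[(fun w => (d (X x t w) x0)%:E)] <= C%:E)%E) /\
   (forall x, exists (C : R) (s0 : nat), forall s : nat, (s0 <= s)%N -> forall t : int,
      ('N[P]_(p%:E)[(fun w => (d (fiter F zeta s.+1 (t - s%:Z) x w) (X x t w))%:E)]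
          <= (C * kappa `^ (s%:R / m%:R))%:E)%E) /\
   (forall x (t : int), {ae P, forall w,
      ((fun s : nat => d (fiter F zeta s.+1 (t - s%:Z) x w) (X x t w)) @ \oo --> 0)}) /\
   (* 2. *)
   (forall x y (t : int), x <> y -> P [set w | X x t w <> X y t w] = 0%E) /\
   (* 3. *)
   (forall x, stationary P zeta -> stationary P (fun t w => (X x t w, zeta t w))) /\
   (forall x, ergodic P zeta -> ergodic P (fun t w => (X x t w, zeta t w))) /\
   (* 4. *)
   (forall Y : int -> Omega -> E,
      (forall t, meas_wrt (Fl t) (Y t)) ->
      (forall t w, Y t w = F (Y (t - 1) w, zeta t w)) ->
      (exists C : R, forall j : int,
         (\int[P]_w ((d (Y j w) x0) `^ p)%:E <= C%:E)%E) ->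
      forall x (t : int), {ae P, forall w, Y t w = X x t w}).
Proof.
move=> dP _ mF FlP Flzeta p1 L0 kappa01 m0 [C1 A1] A2.
have [C0 C0_gt0 contr] := fiter_contraction dP mF FlP Flzeta p1 L0 kappa01 m0 A2.
have th0 := @rate_gt0 R kappa m kappa01; have th1 := @rate_lt1 R kappa m kappa01 m0.
exists (fun x t w => orbit_limit d F x0 x (fun j => zeta (t + j) w)).
split; first by move=> x t; exact: (measurable_stationary d F zeta x0 dP mF FlP Flzeta).
split.
  exact: (Lpdist_stationary_bounded P d F zeta x0 dP mF FlP Flzeta p1
    th0 th1 C0_gt0 A1 contr).
split.
  move=> x.
  have [B B0 gB] := Lpdist_pullback_limit P d F zeta x0 dP mF FlP Flzeta p1
    th0 th1 C0_gt0 A1 contr x.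
  (* The estimate holds from [s = 0] on; [rate_exp] identifies the rate with [theta ^+ s]. *)
  exists B, 0%N => s _ t; rewrite -rate_exp//; exact: gB.
split; first exact: (ae_cvg_pullback P d F zeta x0 dP mF FlP Flzeta p1
    th0 th1 C0_gt0 A1 contr).
split.
  move=> x y t _.
  exact: (stationary_start_indep P d F zeta x0 dP mF FlP Flzeta p1
    th0 th1 C0_gt0 A1 contr).
split; first by move=> x; exact: stationary_orbit_limit.
split; first by move=> x; exact: ergodic_orbit_limit.
move=> Y mY YF [C YC].
exact: (solution_unique P d F zeta x0 dP mF FlP Flzeta p1
    th0 th1 C0_gt0 A1 contr Y C).
Qed.
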